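(* Let $\kappa\in\overline S$ and $\gamma,\mu\in\mathcal D^\sigma$ with $\kappa\in\tau(\gamma)$, $\kappa\in\tau(\mu)$ and $t_\mu(\kappa)\in\{\mathtt{1C\text{-}},\mathtt{1r1f},\mathtt{2C\text{-}},\mathtt{2r11},\mathtt{3C\text{-}},\mathtt{2Cr},\mathtt{3Cr},\mathtt{3r}\}$. Call a quantity \emph{known} if it can be computed from the combinatorial data (the set $\mathcal D^\sigma$, its order, lengths, types, cross actions, Cayley transforms and signs $\epsilon$) together with the polynomials $\widehat P(\nu,\mu')$ for all $\nu$ and all $\mu'$ with $\ell(\mu')<\ell(\mu)$, and the polynomials $\widehat P(\gamma',\mu)$ for all $\gamma'$ with $\ell(\gamma')>\ell(\gamma)$; that is, if it is a function of these data only. Then: (a) $\widehat P(\gamma,\mu)$ is known (all terms necessary to compute it are known), unless $\mathrm{def}_\mu(\kappa)=1$ and $\ell(\mu)-\ell(\gamma)$ is odd and positive. (b) If $\mathrm{def}_\mu(\kappa)=1$, i.e. $t_\mu(\kappa)\in\{\mathtt{2Cr},\mathtt{3Cr},\mathtt{3r}\}$, and $\ell(\mu)-\ell(\gamma)$ is odd, then $$(v+v^{-1})\widehat P(\gamma,\mu)=c\,\mu_{-1}(\gamma,\mu)+( * ),$$ where $c\in\{1,2\}$ and $( * )\in\mathbb Z[v,v^{-1}]$ are known; and this equation can be solved for $\widehat P(\gamma,\mu)$, i.e. it determines $\widehat P(\gamma,\mu)$ from known data.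
   Context: Setting (Lusztig–Vogan). $G$ is a complex connected reductive group, $\theta$ a Cartan involution, $K=G^\theta$, $H\subset B$ a Cartan and a Borel subgroup, $(W,S)$ the Weyl group with its simple reflections. $\sigma$ is an automorphism of $G$ commuting with $\theta$, preserving $(B,H)$ and inducing an involution $\sigma$ of $(W,S)$. $\mathcal D$ is the finite set of irreducible $K$-equivariant local systems on $K$-orbits on $G/B$, with its length $\ell$, cross action $w\times\gamma$ of $W$, and (possibly multivalued) Cayley transforms $\gamma^\alpha$ (noncompact imaginary $\alpha$), $\gamma_\alpha$ (real parity $\alpha$). $\mathcal D^\sigma$ is the set of $\sigma$-fixed elements. $\overline S$ is the set of $\sigma$-orbits on $S$. For $\kappa=\{s_\alpha\}$ or $\{s_\alpha,s_\beta\}$ ($\beta=\sigma\alpha$), $w_\kappa$ is the longest element of the group generated by $\kappa$ and $\ell(\kappa)=\ell(w_\kappa)$: it is $1$ if $\sigma\alpha=\alpha$, $2$ if $\alpha\neq\beta$ are orthogonal, $3$ if $\langle\alpha,\beta^\vee\rangle=-1$. Types. For $\gamma\in\mathcal D^\sigma$, $\kappa\in\overline S$ the type $t_\gamma(\kappa)$ (leading digit $k=\ell(\kappa)$) is one of: Ascents ($\kappa\notin\tau(\gamma)$): 1C+, 1i1, 1i2f, 1i2s, 1rn; 2C+, 2Ci, 2i11, 2i12, 2i22, 2rn; 3C+, 3Ci, 3i, 3rn. Descents ($\kappa\in\tau(\gamma)$): 1C-, 1r1f, 1r1s, 1r2, 1ic; 2C-, 2Cr, 2r11, 2r21, 2r22,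 2ic; 3C-, 3Cr, 3r, 3ic. $\tau(\gamma)$ is the set of descents. Here C$\pm$: $\alpha$ (and $\beta$) complex, $\pm\theta\alpha>0$, $\theta\alpha\ne\pm\beta$ if $k>1$; Ci: $\theta\alpha=\beta$; Cr: $\theta\alpha=-\beta$; ic: compact imaginary; rn: real not satisfying the parity condition; the remaining i- (resp. r-) types: noncompact imaginary (resp. real parity). 1i1: type 1; 1i2f, 1i2s: type 2 with $\sigma$ fixing, resp. switching, the two values of $\gamma^\alpha$; 1r1f, 1r1s: type 1 with $\sigma$ fixing, resp. switching, the two values of $\gamma_\alpha$; 1r2: type 2; 2i11, 2i12, 2i22: $(\gamma^\alpha)^\beta$ has $1,2,4$ values; 2r22, 2r21, 2r11: $(\gamma_\alpha)_\beta$ has $1,2,4$ values. The $\kappa$-Cayley transforms are: $\gamma^\kappa=\gamma^\alpha$, $\gamma_\kappa=\gamma_\alpha$ for 1i1,1i2f,1r1f,1r2; $\gamma^\kappa=(\gamma^\alpha)^\beta$, $\gamma_\kappa=(\gamma_\alpha)_\beta$ for 2i11,2i12,2r22,2r21, and the two $\sigma$-fixed elements of these sets for 2i22, 2r11; $s_\alpha\times\gamma=s_\beta\times\gamma$ for 2Ci ($\gamma^\kappa$) and 2Cr ($\gamma_\kappa$); $\gamma^\kappa=(s_\alpha\times\gamma)^\beta\cap(s_\beta\times\gamma)^\alpha$ for 3Ci and $\gamma_\kappa=(s_\alpha\times\gamma)_\beta\cap(s_\beta\times\gamma)_\alpha$ for 3Cr; $\gamma^\kappa=s_\alpha\times\gamma^\beta=s_\beta\times\gamma^\alpha$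 for 3i and $\gamma_\kappa=s_\alpha\times\gamma_\beta=s_\beta\times\gamma_\alpha$ for 3r. Two values are denoted $\gamma^\kappa_1,\gamma^\kappa_2$ or $\gamma_\kappa^1,\gamma_\kappa^2$. Up- and down-transforms are mutually inverse relations, matching 1i1/1r1f, 1i2f/1r2, 2Ci/2Cr, 2i11/2r11, 2i12/2r21, 2i22/2r22, 3Ci/3Cr, 3i/3r; in types 1r2, 2r22 the parameters $\gamma\neq w_\kappa\times\gamma$ have the same type and the same $\gamma_\kappa$; $w_\kappa\times$ exchanges $k$C+ and $k$C-. Module. $u=v^2$. $M$ is the Lusztig–Vogan module, free over $\mathbb Z[v,v^{-1}]$ with basis $a_\gamma$ ($\gamma\in\mathcal D^\sigma$), for the Hecke algebra generated by the $T_{w_\kappa}$ with $(T_{w_\kappa}+1)(T_{w_\kappa}-u^{\ell(\kappa)})=0$. Standing assumption: extensions of parameters have been chosen so that, with $k=\ell(\kappa)$, $T_{w_\kappa}a_\gamma$ equals $k$C+: $a_{w_\kappa\times\gamma}$; $k$C-: $(u^k-1)a_\gamma+u^ka_{w_\kappa\times\gamma}$; 1i1, 2i11: $a_{w_\kappa\times\gamma}+a_{\gamma^\kappa}$; 1i2f, 2i22: $a_\gamma+a_{\gamma^\kappa_1}+a_{\gamma^\kappa_2}$; 2i12: $a_\gamma+\sum_{\gamma'\xrightarrow{\kappa}\gamma}\epsilon(\gamma',\gamma)a_{\gamma'}$; 2Ci, 3Ci, 3i: $ua_\gamma+(u+1)a_{\gamma^\kappa}$; 1i2s, 1rn, 2rn,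 3rn: $-a_\gamma$; 1ic, 2ic, 3ic, 1r1s: $u^ka_\gamma$; 1r1f, 2r11: $(u^k-2)a_\gamma+(u^k-1)(a_{\gamma_\kappa^1}+a_{\gamma_\kappa^2})$; 1r2, 2r22: $(u^k-1)a_\gamma-a_{w_\kappa\times\gamma}+(u^k-1)a_{\gamma_\kappa}$; 2r21: $(u^2-2)a_\gamma+(u^2-1)\sum_{\gamma\xrightarrow{\kappa}\gamma'}\epsilon(\gamma,\gamma')a_{\gamma'}$; 2Cr, 3Cr, 3r: $(u^k-u-1)a_\gamma+(u^k-u)a_{\gamma_\kappa}$. Arrows: $\gamma\xrightarrow{\kappa}\lambda$ means $\kappa\in\tau(\gamma)$, $\kappa\notin\tau(\lambda)$ and $a_\lambda$ appears in $T_{w_\kappa}a_\gamma$. Signs: for $\gamma\xrightarrow{\kappa}\lambda$, $\epsilon(\gamma,\lambda)=1$ unless $t_\gamma(\kappa)=$ 2r21; in that case $\gamma$ belongs to an ordered pair $(\gamma_1,\gamma_2)$ with $\{\gamma_1,\gamma_2\}=\{\gamma,s_\alpha\times\gamma\}$, $\lambda$ to an ordered pair $(\lambda_1,\lambda_2)$ of 2i12 parameters whose underlying set is the common Cayley transform of $\gamma_1,\gamma_2$ (chosen orderings), and $\epsilon(\gamma_i,\lambda_j)=-1$ if $i=j=2$ and $1$ otherwise. Defect: $\mathrm{def}_\gamma(\kappa)=1$ if $t_\gamma(\kappa)\in\{$2Ci, 3Ci, 3i, 2Cr, 3Cr, 3r$\}$, else $0$; if $\gamma\xrightarrow{\kappa}\lambda$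 then $\ell(\gamma)-\ell(\lambda)=\ell(\kappa)-\mathrm{def}_\gamma(\kappa)$ and $\mathrm{def}_\lambda(\kappa)=\mathrm{def}_\gamma(\kappa)$. Normalizations: $\hat a_\gamma=v^{-\ell(\gamma)}a_\gamma$, $\widehat T_\kappa=v^{-\ell(\kappa)}(T_{w_\kappa}+1)$. Canonical basis (Lusztig–Vogan, recalled). $\mathcal D^\sigma$ has a partial order $\le$ with $\gamma<\delta\Rightarrow\ell(\gamma)<\ell(\delta)$. $M$ has a canonical additive involution $\mathbf D$, semilinear for $v\mapsto v^{-1}$, commuting with every $\widehat T_\kappa$, and a unique basis $\widehat C_\delta=\sum_\gamma\widehat P(\gamma,\delta)\hat a_\gamma$ ($\delta\in\mathcal D^\sigma$) with $\mathbf D\widehat C_\delta=\widehat C_\delta$, $\widehat P(\gamma,\delta)\neq0\Rightarrow\gamma\le\delta$, $\widehat P(\delta,\delta)=1$, $\widehat P(\gamma,\delta)\in v^{-1}\mathbb Z[v^{-1}]$ for $\gamma\ne\delta$; moreover $\widehat P(\gamma,\delta)=v^{\ell(\gamma)-\ell(\delta)}P(\gamma,\delta)(v^2)$ with $P(\gamma,\delta)$ an integer polynomial. Also $\kappa\in\tau(\lambda)$ iff $\widehat T_\kappa\widehat C_\lambda=(v^{\ell(\kappa)}+v^{-\ell(\kappa)})\widehat C_\lambda$. $\mu_{-1}(\gamma,\delta)$ is the coefficient of $v^{-1}$ in $\widehat P(\gamma,\delta)$. The paper computes the $\widehat P(\gamma,\mu)$ inductively, assuming the polynomials listed in the definition of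 ''known'' have already been computed. The order, and hence any quantity built from it, counts as part of the combinatorial data; the explicit formulas above define the action of $\widehat T_\kappa$ in terms of these data. *)

(* Defs.v *)
From HB Require Import structures.
From mathcomp Require Import all_boot all_order all_algebra all_fingroup.
From mathcomp Require Import finmap.
From mathcomp.multinomials Require Import monalg.

Set Implicit Arguments.
Unset Strict Implicit.
Unset Printing Implicit Defensive.

Import GRing.Theory.
Local Open Scope ring_scope.

(** * Laurent polynomials Z[v, v^-1]

    [{malg int[int]}] is the Z-module of finitely supported functions from the
    exponents to Z.  Its product is not in the library, because [monomType]
    requires that only the unit of the exponent monoid be invertible. *)

Definition laurent := {malg int[int]}.
HB.instance Definition _ := GRing.Zmodule.on laurent.

Definition monoL (c i : int) : laurent := mkmalgU i c.
Definition coefL (i : int) (f : laurent) : int := mcoeff i f.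

Section LaurentRing.
Implicit Types f g h : laurent.

Definition mulL f g : laurent :=
  \sum_(i <- msupp f) \sum_(j <- msupp g) monoL (coefL i f * coefL j g) (i + j).

Lemma mulLw (A B : {fset int}) f g :
  (msupp f `<=` A)%fset -> (msupp g `<=` B)%fset ->
  mulL f g =
  \sum_(i <- A) \sum_(j <- B) monoL (coefL i f * coefL j g) (i + j).
Proof.
move=> fA gB; rewrite /mulL (big_fset_incl _ fA) /=.
  apply: eq_bigr => i _; apply: big_fset_incl => // j _ jg.
  by rewrite /coefL (mcoeff_outdom jg) mulr0 /monoL monalgU0.
move=> i _ fi; rewrite big1 // => j _.
by rewrite /coefL (mcoeff_outdom fi) mul0r /monoL monalgU0.
Qed.

Lemma mulLC : commutative mulL.
Proof.
move=> f g; rewrite /mulL exchange_big /=.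
by apply: eq_bigr => i _; apply: eq_bigr => j _; rewrite mulrC addrC.
Qed.

Lemma mulLDl : left_distributive mulL +%R.
Proof.
move=> f g h; pose A := (msupp f `|` msupp g)%fset.
have fA : (msupp f `<=` A)%fset by apply: fsubsetUl.
have gA : (msupp g `<=` A)%fset by apply: fsubsetUr.
have fgA : (msupp (f + g)%R `<=` A)%fset by apply: msuppD_le.
rewrite !(@mulLw A (msupp h)) // -big_split; apply: eq_bigr => i _.
rewrite -big_split; apply: eq_bigr => j _ /=.
by rewrite /coefL mcoeffD mulrDl /monoL monalgUD.
Qed.

Lemma mulLDr : right_distributive mulL +%R.
Proof. by move=> f g h; rewrite mulLC mulLDl !(mulLC f). Qed.

Lemma mul0L : left_zero 0 mulL.
Proof. by move=> f; rewrite /mulL msupp0 big_seq_fset0. Qed.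

Lemma mulL0 : right_zero 0 mulL.
Proof. by move=> f; rewrite mulLC mul0L. Qed.

Lemma mulL_mono (a b i j : int) :
  mulL (monoL a i) (monoL b j) = monoL (a * b) (i + j).
Proof.
rewrite (@mulLw [fset i]%fset [fset j]%fset) ?msuppU_le //.
by rewrite !big_seq_fset1 /coefL !mcoeffUU.
Qed.

Lemma laurentE f : f = \sum_(i <- msupp f) monoL (coefL i f) i.
Proof. exact: monalgE. Qed.

Lemma mulL_suml (I : Type) (r : seq I) (F : I -> laurent) g :
  mulL (\sum_(i <- r) F i) g = \sum_(i <- r) mulL (F i) g.
Proof. exact: (big_morph (mulL^~ g) (fun x y => mulLDl x y g) (mul0L g)). Qed.

Lemma mulL_sumr (I : Type) (r : seq I) (F : I -> laurent) g :
  mulL g (\sum_(i <- r) F i) = \sum_(i <- r) mulL g (F i).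
Proof. exact: (big_morph (mulL g) (mulLDr g) (mulL0 g)). Qed.

Lemma mul1L : left_id (monoL 1 0) mulL.
Proof.
move=> f; rewrite {1}(laurentE f) mulL_sumr [RHS]laurentE.
by apply: eq_bigr => i _; rewrite mulL_mono mul1r add0r.
Qed.

Lemma mulLA : associative mulL.
Proof.
move=> f g h; rewrite (laurentE f) !mulL_suml; apply: eq_bigr => i _.
rewrite (laurentE g) !(mulL_suml, mulL_sumr); apply: eq_bigr => j _.
rewrite (laurentE h) !mulL_sumr; apply: eq_bigr => k _.
by rewrite !mulL_mono mulrA addrA.
Qed.

Lemma onerL_neq0 : monoL 1 0 != 0.
Proof. by rewrite /monoL monalgU_eq0 oner_eq0. Qed.

HB.instance Definition _ := GRing.Zmodule_isComNzRing.Build laurent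
  mulLA mulLC mul1L mulLDl onerL_neq0.

End LaurentRing.

Definition vpow (i : int) : laurent := monoL 1 i.
Definition v : laurent := vpow 1.
Definition u : laurent := v ^+ 2.

(** The ring involution v |-> v^-1. *)
Definition barL (f : laurent) : laurent :=
  \sum_(i <- msupp f) monoL (coefL i f) (- i).

Definition L_of_int (c : int) : laurent := c%:~R.

(** * Types of a simple orbit relative to a parameter *)

Inductive lvtype :=
  | t1Cp | t1i1 | t1i2f | t1i2s | t1rn
  | t2Cp | t2Ci | t2i11 | t2i12 | t2i22 | t2rn
  | t3Cp | t3Ci | t3i | t3rn
  | t1Cm | t1r1f | t1r1s | t1r2 | t1ic
  | t2Cm | t2Cr | t2r11 | t2r21 | t2r22 | t2ic
  | t3Cm | t3Cr | t3r | t3ic.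

Definition is_descent (t : lvtype) : bool :=
  match t with
  | t1Cm | t1r1f | t1r1s | t1r2 | t1ic
  | t2Cm | t2Cr | t2r11 | t2r21 | t2r22 | t2ic
  | t3Cm | t3Cr | t3r | t3ic => true
  | _ => false
  end.

Definition type_defect (t : lvtype) : nat :=
  match t with
  | t2Ci | t3Ci | t3i | t2Cr | t3Cr | t3r => 1
  | _ => 0
  end.

(** The types allowed for mu in the recursion. *)
Definition good_descent (t : lvtype) : bool :=
  match t with
  | t1Cm | t1r1f | t2Cm | t2r11 | t3Cm | t2Cr | t3Cr | t3r => true
  | _ => false
  end.

(** Type of the members of an upward Cayley transform. *)
Definition up_type (t : lvtype) : option lvtype :=
  match t with
  | t1i1 => Some t1r1f | t1i2f => Some t1r2
  | t2Ci => Some t2Cr | t2i11 => Some t2r11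
  | t2i12 => Some t2r21 | t2i22 => Some t2r22
  | t3Ci => Some t3Cr | t3i => Some t3r
  | _ => None
  end.

(** Number of values of gamma^kappa and of gamma_kappa. *)
Definition up_card (t : lvtype) : nat :=
  match t with
  | t1i1 | t2Ci | t2i11 | t3Ci | t3i => 1
  | t1i2f | t2i12 | t2i22 => 2
  | _ => 0
  end.

Definition dn_card (t : lvtype) : nat :=
  match t with
  | t1r2 | t2r22 | t2Cr | t3Cr | t3r => 1
  | t1r1f | t2r11 | t2r21 => 2
  | _ => 0
  end.

(** Effect of w_kappa x on the complex types. *)
Definition complex_swap (t : lvtype) : option lvtype :=
  match t with
  | t1Cp => Some t1Cm | t1Cm => Some t1Cp
  | t2Cp => Some t2Cm | t2Cm => Some t2Cp
  | t3Cp => Some t3Cm | t3Cm => Some t3Cp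
  | _ => None
  end.

(** * Combinatorial data and the module they define *)

Record lvdata := LVData {
  par : finType;                           (* D^sigma *)
  Sbar : finType;
  le : rel par;
  ell : par -> nat;
  lk : Sbar -> nat;
  typ : par -> Sbar -> lvtype;             (* t_gamma(kappa) *)
  crs : Sbar -> par -> par;                (* w_kappa x gamma *)
  up : Sbar -> par -> {set par};           (* values of gamma^kappa *)
  dn : Sbar -> par -> {set par};           (* values of gamma_kappa *)
  eps : Sbar -> par -> par -> int
}.

Section Module.
Variable X : lvdata.
Implicit Types (k : Sbar X) (g d : par X).

Definition tau (g : par X) (k : Sbar X) : bool := is_descent (typ g k).
Definition defect (g : par X) (k : Sbar X) : nat := type_defect (typ g k).

(** The free module on D^sigma: [m g] is the coordinate of m on a_g. *)
Definition LVmod := {ffun par X -> laurent^o}.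

Definition a_ (g : par X) : LVmod := [ffun d => (d == g)%:R : laurent].
Definition ahat (g : par X) : LVmod := vpow (- (ell g)%:Z) *: a_ g.

(** For 2i12 and 2r21 the arrows gamma' -> gamma (resp. gamma -> gamma') are
    those with gamma' in gamma^kappa (resp. gamma_kappa). *)
Definition Tbasis (k : Sbar X) (g : par X) : LVmod :=
  let uk := u ^+ lk k in
  match typ g k with
  | t1Cp | t2Cp | t3Cp => a_ (crs k g)
  | t1Cm | t2Cm | t3Cm => (uk - 1) *: a_ g + uk *: a_ (crs k g)
  | t1i1 | t2i11 => a_ (crs k g) + \sum_(d in up k g) a_ d
  | t1i2f | t2i22 => a_ g + \sum_(d in up k g) a_ d
  | t2i12 => a_ g + \sum_(d in up k g) L_of_int (eps k d g) *: a_ d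
  | t2Ci | t3Ci | t3i => u *: a_ g + (u + 1) *: \sum_(d in up k g) a_ d
  | t1i2s | t1rn | t2rn | t3rn => - a_ g
  | t1ic | t2ic | t3ic | t1r1s => uk *: a_ g
  | t1r1f | t2r11 =>
      (uk - 2%:R) *: a_ g + (uk - 1) *: \sum_(d in dn k g) a_ d
  | t1r2 | t2r22 =>
      (uk - 1) *: a_ g - a_ (crs k g) + (uk - 1) *: \sum_(d in dn k g) a_ d
  | t2r21 =>
      (u ^+ 2 - 2%:R) *: a_ g
      + (u ^+ 2 - 1) *: \sum_(d in dn k g) L_of_int (eps k g d) *: a_ d
  | t2Cr | t3Cr | t3r =>
      (uk - u - 1) *: a_ g + (uk - u) *: \sum_(d in dn k g) a_ d
  end.

Definition T (k : Sbar X) (m : LVmod) : LVmod :=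
  \sum_g (m g : laurent) *: Tbasis k g.

Definition That (k : Sbar X) (m : LVmod) : LVmod :=
  vpow (- (lk k)%:Z) *: (T k m + m).

Definition arrow (k : Sbar X) (g d : par X) : bool :=
  [&& tau g k, ~~ tau d k & T k (a_ g) d != 0].

Definition Chat (P : par X -> par X -> laurent) (d : par X) : LVmod :=
  \sum_g P g d *: ahat g.

(** The involution D of M together with the coefficients of the canonical
    basis it determines. *)
Record canonical_basis := CanonicalBasis {
  Dbar : LVmod -> LVmod;
  Phat : par X -> par X -> laurent;
  Dbar_add : forall m n, Dbar (m + n) = Dbar m + Dbar n;
  Dbar_semilinear : forall (c : laurent) m, Dbar (c *: m) = barL c *: Dbar m;
  Dbar_invol : forall m, Dbar (Dbar m) = m;
  Dbar_That : forall k m, Dbar (That k m) = That k (Dbar m);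
  Dbar_Chat : forall d, Dbar (Chat Phat d) = Chat Phat d;
  Phat_le : forall g d, Phat g d != 0 -> le g d;
  Phat_diag : forall d, Phat d d = 1;
  Phat_neg : forall g d, g != d ->
    forall i : int, (0 <= i)%R -> coefL i (Phat g d) = 0;
  Phat_poly : forall g d, exists p : {poly int},
    Phat g d = vpow ((ell g)%:Z - (ell d)%:Z) * (map_poly L_of_int p).[v ^+ 2];
  tau_Chat : forall k d,
    tau d k <-> That k (Chat Phat d)
                = (vpow (lk k)%:Z + vpow (- (lk k)%:Z)) *: Chat Phat d
}.

(** mu_{-1}(gamma, delta) *)
Definition mu1 (B : canonical_basis) (g d : par X) : int :=
  coefL (- 1) (Phat B g d).

(** The polynomials assumed already computed when Phat(g, m) is sought; the
    other entries are masked by 0, the mask depending on lengths only. *)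
Definition known_part (B : canonical_basis) (g m : par X) :
    par X -> par X -> laurent :=
  fun n m' =>
    if (ell m' < ell m)%N || (m' == m) && (ell g < ell n)%N
    then Phat B n m' else 0.

End Module.

(** A quantity indexed by (kappa, gamma, mu) is known when it is given by such
    a function, applied to the combinatorial data and to [known_part]. *)
Definition known_function (A : Type) : Type :=
  forall X : lvdata, Sbar X -> par X -> par X ->
    (par X -> par X -> laurent) -> A.

(** * Based root data *)

Definition dotL (n : nat) (x y : 'rV[int]_n) : int := (x *m y^T) 0 0.

Record based_root_datum := BasedRootDatum {
  rd_rank : nat;
  rootT : finType;
  rt : rootT -> 'rV[int]_rd_rank;          (* roots in X^*(H) *)
  crt : rootT -> 'rV[int]_rd_rank;         (* coroots in X_*(H) *)
  refl : rootT -> {perm rootT};            (* s_alpha acting on the roots *)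
  pos : {set rootT};                       (* roots of B *)
  simple : {set rootT};
  rt_inj : injective rt;
  rt_crt : forall a, dotL (rt a) (crt a) = 2;
  rt_refl : forall a b, rt (refl a b) = rt b - dotL (rt b) (crt a) *: rt a;
  crt_refl : forall a b, crt (refl a b) = crt b - dotL (rt a) (crt b) *: crt a;
  rt_reduced : forall a b (c : int),
    rt b = c *: rt a -> b = a \/ b = refl a a;
  simple_free : forall c : rootT -> int,
    \sum_(a in simple) c a *: rt a = 0 -> {in simple, forall a, c a = 0};
  posP : forall b, b \in pos <->
    exists c : rootT -> nat, rt b = \sum_(a in simple) (c a)%:Z *: rt a;
  pos_opp : forall b, (refl b b \in pos) = (b \notin pos)
}.

Section RootDatum.
Variable R : based_root_datum.

Definition opp_root (a : rootT R) : rootT R := refl a a.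

Definition pairing (a b : rootT R) : int := dotL (rt a) (crt b).

(** Products in [{perm _}] are read from left to right. *)
Definition Weyl : {group {perm rootT R}} :=
  [group of << [set refl a | a in simple R] >>%g].

Definition wlength (w : {perm rootT R}) : nat :=
  #|[set a in pos R | w a \notin pos R]|.

(** Longest element of the group generated by the reflections in K. *)
Definition wlongest (K : {set rootT R}) : {perm rootT R} :=
  [arg max_(w > 1%g in << [set refl a | a in K] >>%g) wlength w].

Definition rd_automorphism (A : 'M[int]_(rd_rank R)) (f : {perm rootT R}) : Prop :=
  [/\ A \in unitmx, forall a, rt (f a) = rt a *m A
    & forall a, crt (f a) *m A^T = crt a].

End RootDatum.

(** * Parameters

    The combinatorial shadow of (G, theta, B, H, sigma) and of the set D of
    irreducible K-equivariant local systems on K-orbits on G/B. *)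

Record lv_setting := LVSetting {
  rd : based_root_datum;
  sg : {perm rootT rd};                    (* sigma on the roots *)
  sgX : 'M[int]_(rd_rank rd);
  sg_aut : rd_automorphism sgX sg;
  sg_simple : forall a, (sg a \in simple rd) = (a \in simple rd);
  sg_invol : forall a, sg (sg a) = a;

  prm : finType;                           (* D *)
  len : prm -> nat;
  sgD : {perm prm};                        (* sigma on D *)
  th : prm -> {perm rootT rd};             (* the Cartan involution at gamma *)
  thX : prm -> 'M[int]_(rd_rank rd);
  ncpt : prm -> {set rootT rd};            (* noncompact imaginary roots *)
  parity : prm -> {set rootT rd};          (* real roots with the parity condition *)
  cross : {perm rootT rd} -> prm -> prm;
  cup : prm -> rootT rd -> {set prm};      (* values of gamma^alpha *)
  cdn : prm -> rootT rd -> {set prm};      (* values of gamma_alpha *)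
  ordD : rel {g : prm | sgD g == g};       (* the order of D^sigma *)
  (* [second K g]: g comes second in its chosen ordered pair for kappa = K *)
  second : {set rootT rd} -> pred prm;

  th_aut : forall g, rd_automorphism (thX g) (th g);
  th_invol : forall g, thX g *m thX g = 1%:M;
  ncpt_imag : forall g a, a \in ncpt g -> th g a = a;
  parity_real : forall g a, a \in parity g -> th g a = opp_root a;

  cross1 : forall g, cross 1%g g = g;
  crossM : forall w1 w2 g, w1 \in Weyl rd -> w2 \in Weyl rd ->
    cross (w1 * w2)%g g = cross w2 (cross w1 g);
  th_cross : forall w g a, w \in Weyl rd ->
    th (cross w g) (w a) = w (th g a);
  ncpt_cross : forall (w : {perm rootT rd}) g a, w \in Weyl rd ->
    (w a \in ncpt (cross w g)) = (a \in ncpt g);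
  parity_cross : forall (w : {perm rootT rd}) g a, w \in Weyl rd ->
    (w a \in parity (cross w g)) = (a \in parity g);

  cup_dom : forall g, {in simple rd, forall a,
    (cup g a != set0) = (a \in ncpt g)};
  cdn_dom : forall g, {in simple rd, forall a,
    (cdn g a != set0) = (a \in parity g)};
  cup_card : forall g, {in simple rd, forall a, (#|cup g a| <= 2)%N};
  cdn_card : forall g, {in simple rd, forall a, (#|cdn g a| <= 2)%N};
  cup_cdn : forall g d, {in simple rd, forall a,
    (d \in cup g a) = (g \in cdn d a)};

  len_sg : forall g, len (sgD g) = len g;
  th_sg : forall g a, th (sgD g) (sg a) = sg (th g a);
  ncpt_sg : forall g a, (sg a \in ncpt (sgD g)) = (a \in ncpt g);
  parity_sg : forall g a, (sg a \in parity (sgD g)) = (a \in parity g);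
  cross_sg : forall w g, w \in Weyl rd ->
    sgD (cross w g) = cross (w ^ sg)%g (sgD g);
  cup_sg : forall g d, {in simple rd, forall a,
    (sgD d \in cup (sgD g) (sg a)) = (d \in cup g a)}
}.

Section Setting.
Variable E : lv_setting.

Definition fixed_prm : finType := {g : prm E | sgD E g == g}.

Definition is_orbit (K : {set rootT (rd E)}) : bool :=
  [exists a, (a \in simple (rd E)) && (K == [set a; sg E a])].

Definition orbits : finType := {K : {set rootT (rd E)} | is_orbit K}.

Lemma orbit_ex (k : orbits) :
  exists a, (a \in simple (rd E)) && (val k == [set a; sg E a]).
Proof. exact/existsP/(valP k). Qed.

(** A simple root alpha with kappa = {s_alpha, s_(sigma alpha)}. *)
Definition orep (k : orbits) : rootT (rd E) := xchoose (orbit_ex k).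

(** 1, 2 or 3: the expected value of l(w_kappa). *)
Definition orbit_kind (a : rootT (rd E)) : nat :=
  if sg E a == a then 1 else if pairing a (sg E a) == 0 then 2 else 3.

(** (gamma^alpha)^beta and (gamma_alpha)_beta *)
Definition cup2 (g : prm E) (a b : rootT (rd E)) : {set prm E} :=
  \bigcup_(d in cup g a) cup d b.
Definition cdn2 (g : prm E) (a b : rootT (rd E)) : {set prm E} :=
  \bigcup_(d in cdn g a) cdn d b.

Definition sg_fixes (A : {set prm E}) : bool := [forall d in A, sgD E d == d].

Definition type1 (g : prm E) (a : rootT (rd E)) : lvtype :=
  if th g a == a then
    if a \notin ncpt g then t1ic
    else if #|cup g a| == 1%N then t1i1
    else if sg_fixes (cup g a) then t1i2f else t1i2s
  else if th g a == opp_root a then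
    if a \notin parity g then t1rn
    else if #|cdn g a| == 1%N then t1r2
    else if sg_fixes (cdn g a) then t1r1f else t1r1s
  else if th g a \in pos (rd E) then t1Cp else t1Cm.

Definition type2 (g : prm E) (a b : rootT (rd E)) : lvtype :=
  if th g a == a then
    if a \notin ncpt g then t2ic
    else match #|cup2 g a b| with 1 => t2i11 | 2 => t2i12 | _ => t2i22 end
  else if th g a == opp_root a then
    if a \notin parity g then t2rn
    else match #|cdn2 g a b| with 1 => t2r22 | 2 => t2r21 | _ => t2r11 end
  else if th g a == b then t2Ci
  else if th g a == opp_root b then t2Cr
  else if th g a \in pos (rd E) then t2Cp else t2Cm.

Definition type3 (g : prm E) (a b : rootT (rd E)) : lvtype :=
  if th g a == a then if a \in ncpt g then t3i else t3ic
  else if th g a == opp_root a then if a \in parity g then t3r else t3rn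
  else if th g a == b then t3Ci
  else if th g a == opp_root b then t3Cr
  else if th g a \in pos (rd E) then t3Cp else t3Cm.

Definition type_at (g : prm E) (a : rootT (rd E)) : lvtype :=
  match orbit_kind a with
  | 1 => type1 g a
  | 2 => type2 g a (sg E a)
  | _ => type3 g a (sg E a)
  end.

Definition cayley_up (g : prm E) (a : rootT (rd E)) : {set prm E} :=
  let b := sg E a in
  match type_at g a with
  | t1i1 | t1i2f => cup g a
  | t2i11 | t2i12 => cup2 g a b
  | t2i22 => [set d in cup2 g a b | sgD E d == d]
  | t2Ci => [set cross (refl a) g]
  | t3Ci => cup (cross (refl a) g) b :&: cup (cross (refl b) g) a
  | t3i => [set cross (refl a) d | d in cup g b]
  | _ => set0
  end.

Definition cayley_dn (g : prm E) (a : rootT (rd E)) : {set prm E} :=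
  let b := sg E a in
  match type_at g a with
  | t1r1f | t1r2 => cdn g a
  | t2r22 | t2r21 => cdn2 g a b
  | t2r11 => [set d in cdn2 g a b | sgD E d == d]
  | t2Cr => [set cross (refl a) g]
  | t3Cr => cdn (cross (refl a) g) b :&: cdn (cross (refl b) g) a
  | t3r => [set cross (refl a) d | d in cdn g b]
  | _ => set0
  end.

Definition fix_typ (g : fixed_prm) (k : orbits) : lvtype :=
  type_at (val g) (orep k).

Definition fix_eps (k : orbits) (g d : fixed_prm) : int :=
  if fix_typ g k is t2r21 then
    if second (val k) (val g) && second (val k) (val d) then -1 else 1
  else 1.

(** [insubd] only restricts the target to D^sigma, see [crs_val] below. *)
Definition lvdata_of : lvdata :=
  @LVData fixed_prm orbits (@ordD E)
    (fun g => len (val g))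
    (fun k => wlength (wlongest (val k)))
    fix_typ
    (fun k g => insubd g (cross (wlongest (val k)) (val g)))
    (fun k g => [set d : fixed_prm | val d \in cayley_up (val g) (orep k)])
    (fun k g => [set d : fixed_prm | val d \in cayley_dn (val g) (orep k)])
    fix_eps.

End Setting.

Fixpoint alternate (A : Type) (f h : A -> A) (n : nat) (x : A) : A :=
  if n is n'.+1 then f (alternate h f n' x) else x.

(** Recalled properties of D^sigma and of the module M. *)
Record lv_facts (E : lv_setting) (X := lvdata_of E) : Prop := LVFacts {
  leD_refl : reflexive (@le X);
  leD_anti : antisymmetric (@le X);
  leD_trans : transitive (@le X);
  ltD_ell : forall g d : par X, le g d -> g != d -> (ell g < ell d)%N;

  pairing_sg : forall a, a \in simple (rd E) -> sg E a != a ->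
    pairing a (sg E a) = 0 \/ pairing a (sg E a) = -1;
  lk_val : forall k : Sbar X, lk k = orbit_kind (orep k);

  crs_val : forall (k : Sbar X) (g : par X),
    val (crs k g) = cross (wlongest (val k)) (val g);
  crs_complex : forall (k : Sbar X) (g : par X) t,
    complex_swap (typ g k) = Some t -> typ (crs k g) k = t;
  crs_r2 : forall (k : Sbar X) (g : par X),
    typ g k = t1r2 \/ typ g k = t2r22 ->
    [/\ crs k g != g, typ (crs k g) k = typ g k & dn k (crs k g) = dn k g];

  cup2_card : forall (k : Sbar X) (g : par X) (a := orep k) (b := sg E a),
    orbit_kind a = 2%N -> a \in ncpt (val g) ->
    #|cup2 (val g) a b| \in [:: 1; 2; 4]%N;
  cdn2_card : forall (k : Sbar X) (g : par X) (a := orep k) (b := sg E a),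
    orbit_kind a = 2%N -> a \in parity (val g) ->
    #|cdn2 (val g) a b| \in [:: 1; 2; 4]%N;
  cayley_2C : forall (k : Sbar X) (g : par X) (a := orep k) (b := sg E a),
    typ g k = t2Ci \/ typ g k = t2Cr ->
    cross (refl a) (val g) = cross (refl b) (val g);
  cayley_3i : forall (k : Sbar X) (g : par X) (a := orep k) (b := sg E a),
    typ g k = t3i ->
    [set cross (refl a) d | d in cup (val g) b]
    = [set cross (refl b) d | d in cup (val g) a];
  cayley_3r : forall (k : Sbar X) (g : par X) (a := orep k) (b := sg E a),
    typ g k = t3r ->
    [set cross (refl a) d | d in cdn (val g) b]
    = [set cross (refl b) d | d in cdn (val g) a];
  up_dn : forall (k : Sbar X) (g d : par X), (d \in up k g) = (g \in dn k d);
  up_typ : forall (k : Sbar X) (g d : par X),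
    d \in up k g -> up_type (typ g k) = Some (typ d k);
  card_up : forall (k : Sbar X) (g : par X), #|up k g| = up_card (typ g k);
  card_dn : forall (k : Sbar X) (g : par X), #|dn k g| = dn_card (typ g k);

  pair_2r21 : forall (k : Sbar X) (g : par X), typ g k = t2r21 ->
    exists g' : par X,
      [/\ val g' = cross (refl (orep k)) (val g), typ g' k = t2r21,
          dn k g' = dn k g
        & second (val k) (val g') = ~~ second (val k) (val g)];
  pair_2i12 : forall (k : Sbar X) (g : par X), typ g k = t2r21 ->
    exists d1 d2 : par X,
      [/\ dn k g = [set d1; d2], ~~ second (val k) (val d1)
        & second (val k) (val d2)];

  arrow_ell : forall (k : Sbar X) (g d : par X), arrow k g d ->
    (ell g)%:Z - (ell d)%:Z = (lk k)%:Z - (defect g k)%:Z;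
  arrow_defect : forall (k : Sbar X) (g d : par X), arrow k g d ->
    defect d k = defect g k;

  T_quadratic : forall (k : Sbar X) (m : LVmod X) (n := T k m - u ^+ lk k *: m),
    T k n + n = 0;
  T_braid : forall (k l : Sbar X) (m : LVmod X)
      (r := #[(wlongest (val k) * wlongest (val l))%g]%g),
    alternate (T k) (T l) r m = alternate (T l) (T k) r m
}.

(* Main.v *)
Require Import Defs.
From HB Require Import structures.
From mathcomp Require Import all_boot all_order all_algebra.
From mathcomp Require Import finmap.
From mathcomp.multinomials Require Import monalg.
From mathcomp Require Import zify ring.

(** Write k for kappa, l(k) for its length, T_k for the normalized operator, P
    for the normalized polynomials, and C_d for the canonical basis.  Since mu
    has a good descent type, there is a parameter lambda, strictly shorter than
    mu, whose only k-raise is mu: lambda is the image of mu under the cross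
    action in the complex case, and any value of the downward Cayley transform
    otherwise ([below_spec]).  Put N = T_k C_lambda.

    The element N is computable, because C_lambda involves only polynomials of
    shorter second index, and it is fixed by the involution D.  Write
    N = sum_d m_d C_d.  Unitriangularity of P gives the recursion, by
    decreasing length,

      m_d = N_d - sum_(l(d') > l(d)) m_d' P(d, d'),

    and D N = N forces every m_d to be invariant under v -> v^-1.

    The leading coefficients m_d are forced.  If g is raised by k to d, the
    coefficient of T_k at (d, g) is a constant when the defect is 0, and a
    constant times v + v^-1 when it is 1 ([Tmat_raise]); in both cases
    l(d) = l(g) + l(k) - defect.  Length bookkeeping then shows that at any d
    with l(d) >= l(mu), d <> mu, only defect 0 raises of g < lambda contribute,
    so N_d lies in v^-1 Z[v^-1] (lemma [hatc_top]).  An element of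
    v^-1 Z[v^-1] which is invariant under v -> v^-1 is 0; hence m_d = 0 for
    these d, and m_mu is 1 or v + v^-1 according to the defect of mu
    ([coords_top]).

    When l(gamma) >= l(mu), P(gamma, mu) is 1 or 0.  Let l(gamma) < l(mu), and
    run the recursion with the known entries only.  The one unknown entry met on the way down to gamma is P(gamma, mu)
    itself, so the result is Y = m_gamma + m_mu P(gamma, mu)
    ([known_coordE]).  The first summand is invariant under v -> v^-1 and drops
    out of Y - bar Y.  The part of negative degree of Y - bar Y is therefore
    P(gamma, mu) in defect 0, and (v + v^-1) P(gamma, mu) - mu_-1(gamma, mu) in
    defect 1 ([known_starE]).  The latter is the equation of part (b) with
    c = 1.

    That equation has at most one solution, since (v + v^-1) f is not a
    constant unless f = 0 ([vv_const0]).  It is solved explicitly by expanding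
    the inverse of v + v^-1 in positive powers of v: multiplication by this
    series moves the unknown constant term to positive degrees, where it can be
    cut off ([solve_vvP]). *)

Set Implicit Arguments.
Unset Strict Implicit.
Unset Printing Implicit Defensive.

Import Order.TTheory GRing.Theory Num.Theory.
Local Open Scope ring_scope.

(** * Laurent polynomials through their coefficients *)

Section Laurent.
Implicit Types (f g h : laurent) (i j : int).

Lemma coefL_ext f g : (forall i, coefL i f = coefL i g) -> f = g.
Proof. by move=> fg; apply/malgP. Qed.

Lemma coefL0 i : coefL i 0 = 0.
Proof. exact: mcoeff0. Qed.

Lemma coefLD i : {morph coefL i : f g / f + g}.
Proof. exact: mcoeffD. Qed.

Lemma coefLN i : {morph coefL i : f / - f}.
Proof. exact: mcoeffN. Qed.

Lemma coefLB i : {morph coefL i : f g / f - g}.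
Proof. exact: mcoeffB. Qed.

Lemma coefL_sum (I : Type) (r : seq I) (Q : pred I) (F : I -> laurent) i :
  coefL i (\sum_(x <- r | Q x) F x) = \sum_(x <- r | Q x) coefL i (F x).
Proof. exact: (big_morph (coefL i) (coefLD i) (coefL0 i)). Qed.

Lemma coefL_mono i c j : coefL i (monoL c j) = if j == i then c else 0.
Proof. by rewrite /coefL mcoeffU; case: eqP. Qed.

Lemma coefL_vpow i j : coefL i (vpow j) = (j == i)%:R.
Proof. by rewrite coefL_mono; case: eqP. Qed.

Lemma vpow0 : vpow 0 = 1.
Proof. by []. Qed.

Lemma coefL1 i : coefL i 1 = (i == 0)%:R.
Proof. by rewrite -vpow0 coefL_vpow eq_sym. Qed.

Lemma vpowD i j : vpow (i + j) = vpow i * vpow j.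
Proof. by rewrite -[RHS]/(mulL _ _) mulL_mono mulr1. Qed.

Lemma vpowX i n : vpow i ^+ n = vpow (i *+ n).
Proof. by elim: n => // n IH; rewrite exprS IH -vpowD mulrS. Qed.

Lemma vpowNK i : vpow i * vpow (- i) = 1.
Proof. by rewrite -vpowD subrr. Qed.

(** Reindexing the exponents by [F] and discarding some of them covers the bar
    involution, the product by a power of v, and truncation at once. *)
Lemma coefL_supp f (a : pred int) (F : int -> int) i :
  injective F ->
  coefL (F i) (\sum_(j <- msupp f | a j) monoL (coefL j f) (F j))
  = if a i then coefL i f else 0.
Proof.
move=> injF; rewrite coefL_sum.
have [fi|fi] := boolP (i \in msupp f); last first.
  rewrite /coefL (mcoeff_outdom fi) if_same big_seq_cond.
  rewrite big1 // => j /andP[fj _].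
  rewrite -/(coefL _ _) coefL_mono; case: eqP => // /injF ji.
  by rewrite ji (negPf fi) in fj.
rewrite big_mkcond (bigD1_seq i) ?fset_uniq //= coefL_mono eqxx.
rewrite big1 ?addr0 // => j ji; case: (a j) => //.
by rewrite coefL_mono; case: eqP => // /injF /eqP; rewrite (negPf ji).
Qed.

Lemma coefL_bar i f : coefL i (barL f) = coefL (- i) f.
Proof.
by rewrite -{1}[i]opprK (@coefL_supp f xpredT -%R) //; exact: oppr_inj.
Qed.

Lemma coefL_vpowM i j f : coefL i (vpow j * f) = coefL (i - j) f.
Proof.
rewrite {1}(laurentE f) -[_ * _]/(mulL _ _) mulL_sumr.
under eq_bigr => n _ do rewrite /vpow mulL_mono mul1r.
rewrite -{1}[i](subrKC j) (@coefL_supp f xpredT (+%R j)) //.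
exact: addrI.
Qed.

Lemma coefL_intM i (c : int) f : coefL i (L_of_int c * f) = c * coefL i f.
Proof.
rewrite /L_of_int (mulrzl f c).
have coefLMn n : coefL i (f *+ n) = coefL i f *+ n by exact: mcoeffMn.
case: c => n; rewrite ?NegzE ?mulrNz -?pmulrn ?coefLN coefLMn -mulr_natl;
  by rewrite ?mulNr natz.
Qed.

Definition negL f : laurent := \sum_(i <- msupp f | i < 0) monoL (coefL i f) i.

Lemma coefL_neg i f : coefL i (negL f) = if i < 0 then coefL i f else 0.
Proof. by rewrite (@coefL_supp f [pred i | i < 0] id). Qed.

Definition is_neg f := forall i, 0 <= i -> coefL i f = 0.

Lemma is_neg_sum (I : finType) (Q : pred I) (F : I -> laurent) :
  (forall x, Q x -> is_neg (F x)) -> is_neg (\sum_(x | Q x) F x).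
Proof.
by move=> Fneg i i0; rewrite coefL_sum big1 // => x Qx; rewrite (Fneg x Qx).
Qed.

Lemma is_neg_intM c f : is_neg f -> is_neg (L_of_int c * f).
Proof. by move=> fn i i0; rewrite coefL_intM fn ?mulr0. Qed.

Lemma negL_id f : is_neg f -> negL f = f.
Proof.
move=> fn; apply: coefL_ext => i; rewrite coefL_neg.
by case: ltP => // i0; rewrite fn.
Qed.

(** The bar involution exchanges positive and negative degrees. *)
Lemma selfdual_neg0 f : barL f = f -> is_neg f -> f = 0.
Proof.
move=> fD fn; apply: coefL_ext => i; rewrite coefL0.
have [i0|i0] := leP 0 i; first exact: fn.
by rewrite -fD coefL_bar fn // oppr_ge0 ltW.
Qed.

Lemma barLD : {morph barL : f g / f + g}.
Proof. by move=> f g; apply: coefL_ext => i; rewrite !(coefL_bar, coefLD). Qed.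

Lemma barLB : {morph barL : f g / f - g}.
Proof. by move=> f g; apply: coefL_ext => i; rewrite !(coefL_bar, coefLB). Qed.

Lemma bar_vpow i : barL (vpow i) = vpow (- i).
Proof. by apply: coefL_ext => j; rewrite coefL_bar !coefL_vpow eqr_oppLR. Qed.

Lemma coef_u i : coefL i u = (i == 2)%:R.
Proof. by rewrite /u vpowX coefL_vpow eq_sym. Qed.

Lemma laurent_neq0 (f : laurent) i : coefL i f != 0 -> f != 0.
Proof. by apply: contraNneq => ->; rewrite coefL0. Qed.

Definition vv : laurent := v + vpow (- 1).

Lemma vv_u1 : vpow (- 1) * (u + 1) = vv.
Proof. by rewrite mulrDr mulr1 /u vpowX -vpowD. Qed.

Lemma bar_vv n : (n <= 1)%N -> barL (vv ^+ n) = vv ^+ n.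
Proof.
case: n => [|[|//]] _; first by rewrite expr0 -vpow0 bar_vpow oppr0.
by rewrite expr1 barLD !bar_vpow opprK addrC.
Qed.

Lemma coefL_vvM i f :
  coefL i (vv * f) = coefL (i - 1) f + coefL (i + 1) f.
Proof. by rewrite mulrDl coefLD !coefL_vpowM opprK. Qed.

(** Truncation of v - v^3 + v^5 - ..., the expansion of 1 / (v + v^-1) in
    positive powers of v. *)
Definition invvv n : laurent := \sum_(i < n) (-1) ^+ i * vpow (i.*2.+1)%:Z.

Lemma mul_vv_invvv n :
  vv * invvv n = 1 - (-1) ^+ n * vpow (n.*2)%:Z.
Proof.
elim: n => [|n IH]; first by rewrite /invvv big_ord0 mulr0 mul1r subrr.
rewrite /invvv big_ord_recr /= mulrDr IH exprS.
rewrite mulrCA mulrDl -!vpowD.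
have -> : 1 + n.*2.+1%:Z = (n.+1).*2%:Z by lia.
have -> : -1 + n.*2.+1%:Z = n.*2%:Z by lia.
by ring.
Qed.

Lemma coefL_signM n f i : coefL i ((-1) ^+ n * f) = (-1) ^+ n * coefL i f.
Proof.
elim: n => [|n IH]; first by rewrite !mul1r.
by rewrite !exprS -!mulrA !mulN1r coefLN IH.
Qed.

Definition solve_vv n (s : laurent) : laurent := negL (s * invvv n).

(** Multiplying the equation by [invvv n] turns its left-hand side into f,
    up to an error c f v^(2n) with c = 1 or -1, of nonnegative degrees by the
    lower bound on f; the unknown constant is moved to positive degrees.
    Truncation removes both. *)
Lemma solve_vvP n f c s : is_neg f ->
    (forall i, i < - n%:Z -> coefL i f = 0) ->
  vv * f = L_of_int c + s -> solve_vv n s = f.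
Proof.
move=> fneg fn fs; rewrite -[RHS](negL_id fneg) /solve_vv.
have -> : s * invvv n
    = f - (-1) ^+ n * (vpow (n.*2)%:Z * f) - L_of_int c * invvv n.
  have -> : s = vv * f - L_of_int c by rewrite fs addrC addKr.
  rewrite mulrBl -mulrA [f * _]mulrC mulrA mul_vv_invvv.
  by ring.
apply: coefL_ext => i; rewrite !coefL_neg; case: ltP => // i0.
rewrite !coefLB coefL_signM coefL_vpowM (fn (i - _)) ?mulr0 ?subr0; last by lia.
rewrite coefL_intM /invvv coefL_sum big1 ?mulr0 ?subr0 // => j _.
by rewrite coefL_signM coefL_vpow; case: eqP; [lia | rewrite mulr0].
Qed.

(** The coefficients satisfy d_(i+2) = - d_i except for i = -1.  Finite support
    kills the nonnegative indices going up, and the negative ones going down. *)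
Lemma vv_const0 f : vv * f = L_of_int (coefL (- 1) f) -> f = 0.
Proof.
move=> E; have rec i : coefL (i - 1) f + coefL (i + 1) f
    = if i == 0 then coefL (- 1) f else 0.
  rewrite -coefL_vvM E -[L_of_int _]mulr1 coefL_intM coefL1.
  by case: eqP; rewrite ?mulr1 ?mulr0.
(* A crude bound on the absolute value of the exponents of f. *)
pose b := (\sum_(i <- msupp f) `|i|%N)%N.
have fb i : (b < `|i|%N)%N -> coefL i f = 0.
  move=> bi; apply: mcoeff_outdom; apply: contraL bi => fi.
  by rewrite -leqNgt /b (big_rem i) //= leq_addr.
have up n i : 0 <= i -> (b < n + `|i|%N)%N -> coefL i f = 0.
  elim: n i => [|n IH] i i0 bi; first exact: fb.
  have := rec (i + 1); rewrite addrK (IH (i + 1 + 1)) ?addr0; try by lia.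
  by move=> ->; case: eqP => //; lia.
have dn n i : i < 0 -> (b < n + `|i|%N)%N -> coefL i f = 0.
  elim: n i => [|n IH] i i0 bi; first exact: fb.
  have := rec (i - 1); rewrite subrK (IH (i - 1 - 1)) ?add0r; try by lia.
  by move=> ->; case: eqP => //; lia.
apply: coefL_ext => i; rewrite coefL0.
by have [i0|i0] := leP 0 i; [apply: (up b.+1) | apply: (dn b.+1)] => //; lia.
Qed.

End Laurent.

(** * The Hecke module in coordinates *)

Section Module.
Variable X : lvdata.
Implicit Types (k : Sbar X) (g d m l : par X) (x y : LVmod X).

Lemma scaleE (c : laurent) x d : (c *: x) d = c * (x d : laurent) :> laurent.
Proof. by rewrite ffunE. Qed.

Lemma addE x y d : (x + y) d = (x d : laurent) + (y d : laurent) :> laurent.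
Proof. by rewrite ffunE. Qed.

Lemma oppE x d : (- x) d = - (x d : laurent) :> laurent.
Proof. by rewrite ffunE. Qed.

Lemma a_E g d : a_ g d = (d == g)%:R.
Proof. by rewrite ffunE. Qed.

Lemma sumE (I : Type) (r : seq I) (Q : pred I) (F : I -> LVmod X) d :
  (\sum_(i <- r | Q i) F i) d = \sum_(i <- r | Q i) F i d.
Proof. by rewrite sum_ffunE. Qed.

Lemma sum_a_E (A : {set par X}) (c : par X -> laurent) d :
  (\sum_(x in A) c x *: a_ x) d = c d * (d \in A)%:R.
Proof.
rewrite sumE; under eq_bigr => x _ do rewrite scaleE a_E.
have [dA|dA] := boolP (d \in A).
  rewrite (bigD1 d) //= eqxx big1 ?addr0 // => x /andP[_ /negPf xd].
  by rewrite eq_sym xd mulr0.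
rewrite big1 ?mulr0 // => x xA; case: eqP => [dx|_]; last by rewrite mulr0.
by rewrite dx xA in dA.
Qed.

Lemma sum_aE (A : {set par X}) d :
  (\sum_(x in A) a_ x) d = (d \in A)%:R.
Proof.
under eq_bigr => x _ do rewrite -[a_ x]scale1r.
by rewrite (@sum_a_E A (fun=> 1)) mul1r.
Qed.

Lemma T_E k x d : T k x d = \sum_g x g * Tbasis k g d.
Proof. by rewrite sumE; apply: eq_bigr => g _; rewrite scaleE. Qed.

Lemma T_linear k : linear (T k).
Proof.
move=> c x y; apply/ffunP => d; rewrite addE scaleE !T_E mulr_sumr -big_split.
by apply: eq_bigr => g _; rewrite addE scaleE mulrDl mulrA.
Qed.

HB.instance Definition _ k :=
  GRing.isLinear.Build laurent (LVmod X) (LVmod X) *:%R (T k) (T_linear k).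

Lemma T_a k g : T k (a_ g) = Tbasis k g.
Proof.
apply/ffunP => d; rewrite T_E (bigD1 g) //= a_E eqxx mul1r big1 ?addr0 //.
by move=> g' /negPf g'g; rewrite a_E g'g mul0r.
Qed.

Lemma Tbasis_E k g d (q := u ^+ lk k) : Tbasis k g d =
  match typ g k with
  | t1Cp | t2Cp | t3Cp => (d == crs k g)%:R
  | t1Cm | t2Cm | t3Cm => (q - 1) * (d == g)%:R + q * (d == crs k g)%:R
  | t1i1 | t2i11 => (d == crs k g)%:R + (d \in up k g)%:R
  | t1i2f | t2i22 => (d == g)%:R + (d \in up k g)%:R
  | t2i12 => (d == g)%:R + L_of_int (eps k d g) * (d \in up k g)%:R
  | t2Ci | t3Ci | t3i => u * (d == g)%:R + (u + 1) * (d \in up k g)%:R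
  | t1i2s | t1rn | t2rn | t3rn => - (d == g)%:R
  | t1ic | t2ic | t3ic | t1r1s => q * (d == g)%:R
  | t1r1f | t2r11 => (q - 2%:R) * (d == g)%:R + (q - 1) * (d \in dn k g)%:R
  | t1r2 | t2r22 => (q - 1) * (d == g)%:R - (d == crs k g)%:R
                    + (q - 1) * (d \in dn k g)%:R
  | t2r21 => (u ^+ 2 - 2%:R) * (d == g)%:R
             + (u ^+ 2 - 1) * (L_of_int (eps k g d) * (d \in dn k g)%:R)
  | t2Cr | t3Cr | t3r =>
      (q - u - 1) * (d == g)%:R + (q - u) * (d \in dn k g)%:R
  end.
Proof.
by rewrite /Tbasis -/q; case: (typ g k);
  rewrite ?(addE, oppE, scaleE, a_E, sum_aE, sum_a_E).
Qed.

(** Coordinates in the basis of the [ahat]. *)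
Definition hatc x d : laurent := vpow (ell d)%:Z * x d.

Lemma hatc_inj x y : hatc x =1 hatc y -> x = y.
Proof.
move=> xy; apply/ffunP => d.
rewrite -[x d]mul1r -[y d]mul1r -(vpowNK (- (ell d)%:Z)) opprK -!mulrA.
by congr (_ * _); apply: xy.
Qed.

Lemma Chat_E P m d : Chat P m d = P d m * vpow (- (ell d)%:Z).
Proof.
rewrite /Chat sumE (bigD1 d) //= !scaleE a_E eqxx mulr1 big1 ?addr0 // => g.
by move=> /negPf gd; rewrite !scaleE a_E eq_sym gd !mulr0.
Qed.

Lemma hatc_Chat P m d : hatc (Chat P m) d = P d m.
Proof. by rewrite /hatc Chat_E mulrCA vpowNK mulr1. Qed.

(** Matrix of [That k] in the basis of the [ahat]. *)
Definition Tmat k g d : laurent :=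
  vpow ((ell d)%:Z - (ell g)%:Z - (lk k)%:Z) * (Tbasis k g d + (d == g)%:R).

Lemma hatc_That_Chat P k m d :
  hatc (That k (Chat P m)) d = \sum_g P g m * Tmat k g d.
Proof.
rewrite /hatc /That scaleE addE T_E.
have -> : Chat P m d = \sum_g Chat P m g * (d == g)%:R.
  rewrite (bigD1 d) //= eqxx mulr1 big1 ?addr0 // => g /negPf gd.
  by rewrite eq_sym gd mulr0.
rewrite -big_split mulrA mulr_sumr; apply: eq_bigr => g _ /=.
by rewrite Chat_E /Tmat !vpowD; ring.
Qed.

Definition coords_step (Q : par X -> par X -> laurent) (c : par X -> laurent)
    (f : par X -> laurent) d : laurent :=
  c d - \sum_(d' | (ell d < ell d')%N) f d' * Q d d'.

Definition max_ell : nat := \max_(d : par X) ell d.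

(** For a unitriangular [Q], the solution f of c = sum_d' f d' * Q(-, d').
    Each step settles the parameters of one more length, from the greatest
    downwards.  Only the entries of [Q] whose second index is strictly longer
    are read, so that the value at d does not depend on the entries Q(d'', -)
    with d'' shorter than d. *)
Definition coords Q (c : par X -> laurent) : par X -> laurent :=
  iter max_ell.+1 (coords_step Q c) (fun=> 0).

Lemma coords_step_eq Q c f f' n :
    (forall d, (max_ell < n + ell d)%N -> f d = f' d) ->
  forall d, (max_ell < n.+1 + ell d)%N ->
    coords_step Q c f d = coords_step Q c f' d.
Proof.
move=> ff' d nd; rewrite /coords_step; congr (_ - _).
by apply: eq_bigr => d' dd'; rewrite ff' //; lia.
Qed.

Lemma ell_max d : (ell d <= max_ell)%N.
Proof. exact: (@leq_bigmax _ (@ell X)). Qed.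

Lemma coordsE Q c d : coords Q c d = coords_step Q c (coords Q c) d.
Proof.
have H n f f' : forall d, (max_ell < n + ell d)%N ->
    iter n (coords_step Q c) f d = iter n (coords_step Q c) f' d.
  elim: n => [|n IH] d' nd; first by have := ell_max d'; lia.
  by rewrite !iterS; apply: coords_step_eq nd => d''; apply: IH.
rewrite -[RHS]/(iter max_ell.+2 (coords_step Q c) (fun=> 0) d) iterSr.
by apply: H; lia.
Qed.

(** The recursion determines its solution in lengths at least n by itself, which
    is what allows [Q] to be known above a given length only. *)
Lemma coords_unique Q c f n :
    (forall d, (n <= ell d)%N -> f d = coords_step Q c f d) ->
  forall d, (n <= ell d)%N -> f d = coords Q c d.
Proof.
move=> fE d.
have [p] : exists p, (max_ell < p + ell d)%N by exists max_ell.+1; lia.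
elim: p d => [|p IH] d pd nd; first by have := ell_max d; lia.
rewrite fE // coordsE /coords_step; congr (_ - _).
by apply: eq_bigr => d' dd'; rewrite IH //; lia.
Qed.

End Module.

(** * Quantities computed from known data *)

Section Recursion.
Variable X : lvdata.
Implicit Types (k : Sbar X) (g d m l : par X).

(** The parameter lambda whose basis element is hit by [That k]; the last branch
    is a default value, never reached at a good descent. *)
Definition below k m : par X :=
  if complex_swap (typ m k) is Some _ then crs k m
  else if [pick d in dn k m] is Some d then d else m.

(** The longer parameters that T_k reaches from g, when k is an ascent of g. *)
Definition above k g d : bool :=
  if complex_swap (typ g k) is Some _ then d == crs k g else d \in up k g.

(** With P masked to the known entries, this is m_gamma + m_mu P(gamma, mu). *)
Definition known_coord k g m (P : par X -> par X -> laurent) : laurent :=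
  coords P (hatc (That k (Chat P (below k m)))) g.

(** The summand m_gamma is invariant under the bar involution, and drops out of
    the difference. *)
Definition known_star k g m (P : par X -> par X -> laurent) : laurent :=
  if (ell g < ell m)%N then
    negL (known_coord k g m P - barL (known_coord k g m P))
  else 0.

(** The cut-off [ell m] is large enough because P(gamma, mu) has no term of
    degree less than l(gamma) - l(mu). *)
Definition known_Phat k g m (P : par X -> par X -> laurent) : laurent :=
  if g == m then 1
  else if defect m k == 0%N then known_star k g m P
  else solve_vv (ell m) (known_star k g m P).

End Recursion.

(** * Raising operators *)

Definition leading_digit (t : lvtype) : nat :=
  match t with
  | t1Cp | t1i1 | t1i2f | t1i2s | t1rn | t1Cm | t1r1f | t1r1s | t1r2 | t1ic => 1
  | t2Cp | t2Ci | t2i11 | t2i12 | t2i22 | t2rn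
  | t2Cm | t2Cr | t2r11 | t2r21 | t2r22 | t2ic => 2
  | t3Cp | t3Ci | t3i | t3rn | t3Cm | t3Cr | t3r | t3ic => 3
  end.

(** What the recursion needs of the parameters and of the module, with no
    reference to the root datum. *)
Record hecke_rules (X : lvdata) : Prop := HeckeRules {
  rule_lt : forall g d : par X, le g d -> g != d -> (ell g < ell d)%N;
  rule_lk : forall (k : Sbar X) (g : par X), lk k = leading_digit (typ g k);
  rule_eps : forall (k : Sbar X) (g d : par X), eps k g d != 0;
  rule_complex : forall (k : Sbar X) (g : par X) t,
    complex_swap (typ g k) = Some t -> typ (crs k g) k = t;
  rule_r2 : forall (k : Sbar X) (g : par X),
    typ g k = t1r2 \/ typ g k = t2r22 ->
    typ (crs k g) k = typ g k /\ dn k (crs k g) = dn k g;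
  rule_up_dn : forall (k : Sbar X) (g d : par X),
    (d \in up k g) = (g \in dn k d);
  rule_up_typ : forall (k : Sbar X) (g d : par X),
    d \in up k g -> up_type (typ g k) = Some (typ d k);
  rule_card_up : forall (k : Sbar X) (g : par X), #|up k g| = up_card (typ g k);
  rule_card_dn : forall (k : Sbar X) (g : par X), #|dn k g| = dn_card (typ g k);
  rule_arrow : forall (k : Sbar X) (g d : par X), arrow k g d ->
    (ell g + defect g k = ell d + lk k)%N;
  rule_quadratic : forall (k : Sbar X) (m : LVmod X),
    T k (T k m - u ^+ lk k *: m) + (T k m - u ^+ lk k *: m) = 0
}.

Lemma lv_hecke_rules (E : lv_setting) : lv_facts E -> hecke_rules (lvdata_of E).
Proof.
move=> hE; split.
- exact: ltD_ell hE.
- move=> k g; rewrite (lk_val hE) /= /fix_typ /type_at; set a := orep k.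
  have : orbit_kind a = 1%N \/ orbit_kind a = 2%N \/ orbit_kind a = 3%N.
    by rewrite /orbit_kind; do 2?case: ifP => _; auto.
  case=> [->|[->|->]].
  + by rewrite /type1; do ?case: ifP.
  + rewrite /type2; do ?case: ifP => //.
    * by case: #|_| => [|[|[|]]].
    * by move=> *; case: #|_| => [|[|[|]]].
  + by rewrite /type3; do ?case: ifP.
- by move=> k g d; rewrite /= /fix_eps; case: (fix_typ g k) => //; case: ifP.
- exact: crs_complex hE.
- by move=> k g /(crs_r2 hE)[_ ? ?].
- exact: up_dn hE.
- exact: up_typ hE.
- exact: card_up hE.
- exact: card_dn hE.
- by move=> k g d /(arrow_ell hE); lia.
- exact: T_quadratic hE.
Qed.

Section Steps.
Variables (X : lvdata) (hX : hecke_rules X).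
Implicit Types (k : Sbar X) (g d m l : par X).

(** Raising and lowering always change the length. *)
Lemma lk_defect k g : (defect g k < lk k)%N.
Proof. by rewrite /defect (rule_lk hX k g); case: (typ g k). Qed.

Lemma coef_q k i : coefL i (u ^+ lk k) = (i == (lk k).*2%:Z)%:R.
Proof.
rewrite /u !vpowX coefL_vpow eq_sym; congr (_ == _)%:R; lia.
Qed.

Lemma T_Tbasis k g :
  T k (Tbasis k g) = (u ^+ lk k - 1) *: Tbasis k g + u ^+ lk k *: a_ g.
Proof.
have solve (q : laurent) (y t a : LVmod X) :
    y - q *: t + (t - q *: a) = 0 -> y = (q - 1) *: t + q *: a.
  move=> H; apply/eqP; rewrite -subr_eq0 -H scalerBl scale1r opprD opprB.
  by rewrite [t - _]addrC !addrA.
apply: solve; have := rule_quadratic hX k (a_ g).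
by rewrite linearB linearZ /= !T_a.
Qed.

Lemma complex_crs k g : complex_swap (typ g k) ->
  complex_swap (typ (crs k g) k) /\ tau (crs k g) k = ~~ tau g k.
Proof.
case cg: (complex_swap _) => [t|//] _; rewrite /tau (rule_complex hX cg).
by move: cg; case: (typ g k) => //= -[<-].
Qed.

Lemma Tbasis_complex k g : complex_swap (typ g k) -> Tbasis k g =
  if tau g k then (u ^+ lk k - 1) *: a_ g + u ^+ lk k *: a_ (crs k g)
  else a_ (crs k g).
Proof.
by rewrite /Tbasis /tau; case: (typ g k) => cg; first [discriminate cg | done].
Qed.

(** On complex parameters the square of T_k is obtained in two ways, from the
    quadratic relation and from the cross action; the comparison shows that the
    cross action is an involution. *)
Lemma crsK k g : complex_swap (typ g k) -> crs k (crs k g) = g.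
Proof.
move=> cg; have [ccg tcg] := complex_crs cg.
have : T k (Tbasis k g)
    = (u ^+ lk k - 1) *: Tbasis k g + u ^+ lk k *: a_ (crs k (crs k g)).
  have [tg|tg] := boolP (tau g k).
    rewrite {1}(Tbasis_complex cg) tg linearD !linearZ /= !T_a.
    by rewrite (Tbasis_complex ccg) tcg tg.
  rewrite (Tbasis_complex cg) (negPf tg) T_a.
  by rewrite (Tbasis_complex ccg) tcg tg.
rewrite T_Tbasis => /addrI /ffunP/(_ g)/(congr1 (coefL (lk k).*2)).
rewrite !scaleE !a_E eqxx; case: eqP => // _.
by rewrite mulr0 mulr1 coef_q eqxx coefL0.
Qed.

Lemma dn_types k g d : d \in dn k g ->
  [/\ up_type (typ d k) = Some (typ g k), tau g k, ~~ tau d k & d != g].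
Proof.
move=> dg; have gd : g \in up k d by rewrite (rule_up_dn hX).
have ut := rule_up_typ hX gd; rewrite /tau.
have dg' : d != g.
  by apply/eqP => dg'; move: ut; rewrite dg'; case: (typ g k).
by move: ut dg'; case: (typ d k) => //= -[<-].
Qed.

(** The coefficient of [a_ d] does not vanish: it is q - u, which is seen
    in degree 2, or a nonzero integer times q - 1, which is seen in degree 0. *)
Lemma dn_arrow k g d : d \in dn k g -> arrow k g d.
Proof.
move=> dg; have [ut tg td /negPf ndg] := dn_types dg.
apply/and3P; split=> //; rewrite T_a Tbasis_E dg ndg.
have lkg := rule_lk hX k g; have := @rule_r2 _ hX k g.
have cq := coef_q k; move: ut lkg; case tyg: (typ g k) => ut /= lkg.
(* Types without a downward transform. *)
all: try by move: ut; case: (typ d k).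
all: rewrite ?mulr0 ?add0r ?mulr1.
all: try by move=> _; apply: (@laurent_neq0 _ 0);
  rewrite coefLB cq lkg coefL1.
all: try by move=> _; apply: (@laurent_neq0 _ 2);
  rewrite coefLB cq lkg coef_u.
(* In types 1r2 and 2r22 the term of the cross action has a descent type. *)
all: try by case; [by auto | move=> tc _; have -> : (d == crs k g) = false
    by apply/eqP => dc; rewrite -dc in tc; move: td; rewrite /tau tc];
  rewrite oppr0 add0r; apply: (@laurent_neq0 _ 0);
  rewrite coefLB cq lkg coefL1.
move=> _; apply: (@laurent_neq0 _ 0); rewrite mulrC coefL_intM coefLB.
by rewrite /u !vpowX coefL_vpow coefL1 sub0r mulrN1 oppr_eq0 (rule_eps hX).
Qed.

Lemma dn_len k g d : d \in dn k g -> (ell g + defect g k = ell d + lk k)%N.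
Proof. by move/dn_arrow/(rule_arrow hX). Qed.

Lemma crs_len k g : complex_swap (typ g k) -> tau g k ->
  ell g = (ell (crs k g) + lk k)%N.
Proof.
move=> cg tg; have [ccg tcg] := complex_crs cg.
have/(rule_arrow hX) : arrow k g (crs k g).
  rewrite /arrow tg tcg tg T_a (Tbasis_complex cg) tg /=.
  apply: (@laurent_neq0 _ (lk k).*2).
  rewrite addE !scaleE !a_E eqxx mulr1 coefLD coef_q eqxx.
  have -> : (crs k g == g) = false.
    by apply/eqP => gc; move: tcg; rewrite gc tg.
  by rewrite mulr0 coefL0.
by move=> <-; rewrite /defect; move: cg; case: (typ g k); rewrite ?addn0.
Qed.

(** Let d be the upward transform of g, and h_1, h_2 the two values of its
    downward transform.  The quadratic relation at [a_ d] reduces to the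
    equality of (q - 1) (a_(w h_1) + a_(w h_2)) and (q - 1) (a_(h_1) + a_(h_2)),
    where w is the cross action.  As g is one of the h_i, its image is one of
    them too. *)
Lemma crs_i1 k g d : typ g k = t1i1 \/ typ g k = t2i11 -> d \in up k g ->
  crs k g \in dn k d.
Proof.
move=> tg dg; apply: contraT => /negPf cnd; exfalso.
have gd : g \in dn k d by rewrite -(rule_up_dn hX).
have ut := rule_up_typ hX dg.
have TupE h : h \in dn k d -> Tbasis k h = a_ (crs k h) + a_ d.
  move=> hd; have [uth _ _ _] := dn_types hd.
  have dh : d \in up k h by rewrite (rule_up_dn hX).
  have th : typ h k = typ g k.
    by move: uth; case: tg ut => -> [<-]; case: (typ h k).
  have uh : up k h = [set d].
    have/eqP/cards1P[x ux] : #|up k h| = 1%N.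
      by rewrite (rule_card_up hX) th; case: tg => ->.
    by rewrite ux in dh *; rewrite -(set1P dh).
  by rewrite /Tbasis th uh big_set1; case: tg => ->.
have TdE : Tbasis k d = (u ^+ lk k - 2%:R) *: a_ d
    + (u ^+ lk k - 1) *: \sum_(h in dn k d) a_ h.
  by rewrite /Tbasis; case: tg ut => -> [<-].
have card2 : #|dn k d| = 2%N.
  by rewrite (rule_card_dn hX); case: tg ut => -> [<-].
(* The number of the h_i which have the same image as g. *)
pose S : nat := \sum_(h in dn k d) (crs k g == crs k h).
have : T k (Tbasis k d) (crs k g)
  = ((u ^+ lk k - 1) *: Tbasis k d + u ^+ lk k *: a_ d) (crs k g).
  by rewrite T_Tbasis.
have sumT : T k (\sum_(h in dn k d) a_ h)
    = \sum_(h in dn k d) a_ (crs k h) + (a_ d + a_ d).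
  rewrite linear_sum -mulr2n -card2 -sumr_const -big_split.
  by apply: eq_bigr => h hd /=; rewrite T_a TupE.
rewrite {1}TdE linearD !linearZ /= T_a sumT TdE.
have SE : (\sum_(h in dn k d) a_ (crs k h)) (crs k g) = S%:R :> laurent.
  by rewrite sumE natr_sum; apply: eq_bigr => h _; rewrite a_E.
have dE : (\sum_(h in dn k d) a_ h) (crs k g) = 0 :> laurent.
  by rewrite sum_aE cnd.
have ringE (R : comNzRingType) (q e s : R) :
    (q - 2%:R) * ((q - 2%:R) * e + (q - 1) * 0) + (q - 1) * (s + (e + e))
    = (q - 1) * ((q - 2%:R) * e + (q - 1) * 0) + q * e -> (q - 1) * s = 0.
  by move=> /eqP; rewrite -subr_eq0 => /eqP H; rewrite -[RHS]H; ring.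
have evalE (q : laurent) (x y z : LVmod X) c s : y c = 0 -> z c = s ->
    ((q - 2%:R) *: ((q - 2%:R) *: x + (q - 1) *: y)
      + (q - 1) *: (z + (x + x))) c
    = ((q - 1) *: ((q - 2%:R) *: x + (q - 1) *: y) + q *: x) c ->
    (q - 1) * s = 0.
  by move=> y0 <-; rewrite !addE !scaleE !addE !scaleE y0 => /ringE.
move/(evalE _ _ _ _ _ _ dE SE)/(congr1 (coefL 0)).
rewrite mulr_natr -mulr_natl coefL0.
have -> : S%:R = L_of_int S%:Z by [].
rewrite coefL_intM coefLB coef_q coefL1.
have -> : (0 == (lk k).*2%:Z) = false by have := lk_defect k g; lia.
have : (0 < S)%N by rewrite /S (bigD1 g) //= eqxx.
by lia.
Qed.

Lemma up_len k g d : d \in up k g ->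
  ~~ tau g k /\ (ell d + defect g k = ell g + lk k)%N.
Proof.
move=> dg; have gd : g \in dn k d by rewrite -(rule_up_dn hX).
have [ut _ tg _] := dn_types gd; split=> //; rewrite -(dn_len gd) /defect.
by move: ut; case: (typ g k) => //= -[<-].
Qed.

Lemma crs_i1_len k g : typ g k = t1i1 \/ typ g k = t2i11 ->
  ell (crs k g) = ell g.
Proof.
move=> tg; have /set0Pn[d dg] : up k g != set0.
  by rewrite -card_gt0 (rule_card_up hX); case: tg => ->.
have cd := crs_i1 tg dg; have gd : g \in dn k d by rewrite -(rule_up_dn hX).
by have := dn_len cd; have := dn_len gd; lia.
Qed.

Lemma crs_r2_len k g : typ g k = t1r2 \/ typ g k = t2r22 ->
  ell (crs k g) = ell g.
Proof.
move=> tg; have [tc dc] := rule_r2 hX tg.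
have /set0Pn[d dg] : dn k g != set0.
  by rewrite -card_gt0 (rule_card_dn hX); case: tg => ->.
have cd : d \in dn k (crs k g) by rewrite dc.
by have := dn_len cd; have := dn_len dg; rewrite /defect tc; lia.
Qed.

(** A strictly longer [d] can occur in T_k a_g only as a raise of g: the
    downward transforms are shorter than g, and the cross action either is
    itself the raise, or lowers, or preserves the length. *)
Lemma Tbasis_raise k g d : (ell g < ell d)%N ->
  Tbasis k g d = 0 \/
  [/\ (ell d + defect g k = ell g + lk k)%N, above k g d
    & exists c, Tbasis k g d = (u + 1) ^+ defect g k * L_of_int c].
Proof.
move=> gd; have dg : (d == g) = false by apply: contraTF gd => /eqP->; lia.
have dn0 : d \in dn k g = false.
  by apply: contraTF gd => /dn_len; have := lk_defect k g; lia.
have crsF : ell (crs k g) = ell g -> (d == crs k g) = false.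
  by move=> cg; apply: contraTF gd => /eqP->; rewrite cg ltnn.
have [cg|ncg] := boolP (complex_swap (typ g k) : bool).
  have [ccg tcg] := complex_crs cg.
  have def0 : defect g k = 0%N by move: cg; rewrite /defect; case: (typ g k).
  have abE : above k g d = (d == crs k g).
    by rewrite /above; case: complex_swap cg.
  rewrite (Tbasis_complex cg) abE def0 addn0; have [tg|tg] := boolP (tau g k).
    left; rewrite addE !scaleE !a_E dg mulr0 add0r.
    have -> : (d == crs k g) = false; last by rewrite mulr0.
    by apply: contraTF gd => /eqP->; rewrite (crs_len cg tg); lia.
  rewrite a_E; case: eqP => [dc|_]; [right | by left].
  split=> //; last by exists 1; rewrite mul1r.
  by have := crs_len ccg; rewrite tcg crsK // -dc; apply.
have abE : above k g d = (d \in up k g).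
  by rewrite /above; case: complex_swap ncg.
have [ugd|nug] := boolP (d \in up k g).
  have [tg el] := up_len ugd; right; split=> //; first by rewrite abE.
  move: (@crs_i1_len k g) ncg tg; rewrite Tbasis_E dg dn0 ugd /tau /defect.
  case tyg: (typ g k) => //= ceq _ _.
  all: rewrite ?mulr0 ?oppr0 ?add0r ?mulr1 ?crsF ?add0r.
  all: first [ by apply: ceq; auto | by exists 1; rewrite mulr1
             | by exists 0; rewrite mulr0 | idtac].
  by exists (eps k d g); rewrite expr0 mul1r.
left; rewrite Tbasis_E dg dn0 (negPf nug).
move: (@crs_i1_len k g) (@crs_r2_len k g) ncg.
case tyg: (typ g k) => //= ceq1 ceq2 _; rewrite ?mulr0 ?addr0 ?oppr0 //.
all: rewrite crsF ?mulr0n ?subr0 ?addr0 //.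
all: by [apply: ceq1; auto | apply: ceq2; auto].
Qed.

Lemma defect01 k g : defect g k = 0%N \/ defect g k = 1%N.
Proof. by rewrite /defect; case: (typ g k); auto. Qed.

Lemma Tmat_norm k g d c : (ell d + defect g k = ell g + lk k)%N -> d != g ->
    Tbasis k g d = (u + 1) ^+ defect g k * c ->
  Tmat k g d = vv ^+ defect g k * c.
Proof.
move=> el /negPf dg TE; rewrite /Tmat TE dg addr0 mulrA; congr (_ * _).
have -> : (ell d)%:Z - (ell g)%:Z - (lk k)%:Z = - (defect g k)%:Z by lia.
by case: (defect01 k g) => ->; rewrite ?expr0 ?mulr1 ?expr1 ?vv_u1.
Qed.

(** The two normalizations shift the coefficient by v^(-defect), which makes it
    invariant under v -> v^-1. *)
Lemma Tmat_raise k g d : (ell g < ell d)%N ->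
  Tmat k g d = 0 \/
  [/\ (ell d + defect g k = ell g + lk k)%N, above k g d
    & exists c, Tmat k g d = vv ^+ defect g k * L_of_int c].
Proof.
move=> gd; have dg : d != g by apply: contraTN gd => /eqP->; lia.
have [T0|[el ab [c TE]]] := Tbasis_raise k gd.
  by left; rewrite /Tmat T0 (negPf dg) addr0 mulr0.
by right; split=> //; exists c; apply: Tmat_norm.
Qed.

(** The good descents are those whose lower member has a single raise: the
    complex types, and the types whose upward partners are single valued. *)
Lemma below_spec k m (l := below k m) : tau m k -> good_descent (typ m k) ->
  [/\ (ell m + defect m k = ell l + lk k)%N, defect l k = defect m k,
      Tmat k l m = vv ^+ defect m k & forall d, above k l d -> d = m].
Proof.
move=> tm gm; have [cm|ncm] := boolP (complex_swap (typ m k) : bool).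
  have lE : l = crs k m by rewrite /l /below; case: complex_swap cm.
  have [cl tl] := complex_crs cm; have lK := crsK cm.
  rewrite -lE in cl tl lK.
  have def0 g : complex_swap (typ g k) -> defect g k = 0%N.
    by rewrite /defect; case: (typ g k).
  have el : ell m = (ell l + lk k)%N by rewrite (crs_len cm tm) lE.
  rewrite (def0 m) // (def0 l) // addn0; split=> // [|d].
    rewrite -(def0 _ cl) -[RHS]mulr1; apply: Tmat_norm.
    - by rewrite (def0 l) // addn0.
    - by apply: contraTneq tm => ml; rewrite ml in tl *; move: tl; case: tau.
    - by rewrite (def0 l) // mul1r (Tbasis_complex cl) tl tm a_E lK eqxx.
  by rewrite /above; case: complex_swap cl => // _ _ /eqP->.
have /set0Pn dm : dn k m != set0.
  rewrite -card_gt0 (rule_card_dn hX).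
  by move: gm ncm; case: (typ m k).
have ldm : l \in dn k m.
  rewrite /l /below; case: complex_swap ncm => // _.
  by case: pickP => // dn0; case: dm => d; rewrite dn0.
have [utl _ tl /negPf lm] := dn_types ldm.
have mul : m \in up k l by rewrite (rule_up_dn hX).
have defE : defect l k = defect m k.
  by rewrite /defect; move: utl; case: (typ l k) => //= -[<-].
clearbody l; have [_ el] := up_len mul; rewrite defE in el.
have ulm : up k l = [set m].
  have/eqP/cards1P[x ux] : #|up k l| = 1%N.
    rewrite (rule_card_up hX); move: utl gm.
    by case: (typ l k) => //= -[<-].
  by rewrite ux in mul *; rewrite -(set1P mul).
split=> // [|d]; last first.
  rewrite /above ulm inE.
  by move: utl; case: (typ l k) => // _ /eqP.
rewrite -defE -[RHS]mulr1; apply: Tmat_norm; rewrite ?defE //.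
  by apply: contraFneq lm => ->.
have ml : (m == l) = false by apply: contraFF lm => /eqP->.
have crsF : ell (crs k l) = ell l -> (m == crs k l) = false.
  move=> cl; apply/eqP => mc; have := lk_defect k m.
  by have := congr1 (@ell X) mc; rewrite cl; lia.
have ceq := @crs_i1_len k l.
rewrite -defE Tbasis_E mul ml mulr1 /defect.
move: utl gm ceq; case tyl: (typ l k) => //= -[<-] //= _ ceq;
  rewrite ?mulr0 ?add0r ?mulr1 //.
all: by rewrite crsF ?add0r //; apply: ceq; auto.
Qed.

End Steps.

(** * Action on the canonical basis *)

Section Canonical.
Variables (X : lvdata) (hX : hecke_rules X) (B : canonical_basis X).
Implicit Types (k : Sbar X) (g d m l : par X) (x : LVmod X).
Local Notation P := (Phat B).

Lemma Phat_lt g d : P g d != 0 -> g != d -> (ell g < ell d)%N.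
Proof. by move/Phat_le; apply: rule_lt. Qed.

Lemma Phat_eq0 g d : g != d -> (ell d <= ell g)%N -> P g d = 0.
Proof.
move=> gd dg; apply/eqP; apply: contraT => /Phat_lt/(_ gd).
by rewrite ltnNge dg.
Qed.

Lemma Phat_is_neg g d : g != d -> is_neg (P g d).
Proof. exact: Phat_neg. Qed.

(** A bound on the pole of P(g, d), which makes [solve_vv] effective. *)
Lemma Phat_low g d i : i < - (ell d)%:Z -> coefL i (P g d) = 0.
Proof.
move=> id; have [p ->] := Phat_poly B g d.
rewrite coefL_vpowM horner_coef coefL_sum big1 // => j _.
rewrite coef_map_id0 // coefL_intM !vpowX coefL_vpow.
by case: eqP => [|_]; [lia | rewrite mulr0].
Qed.

Lemma sum_unitriangular (f : par X -> laurent) d :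
  \sum_d' f d' * P d d' = f d + \sum_(d' | (ell d < ell d')%N) f d' * P d d'.
Proof.
rewrite (bigD1 d) //= Phat_diag mulr1; congr (_ + _).
rewrite big_mkcond [RHS]big_mkcond; apply: eq_bigr => d' _.
case: eqP => [->|/eqP d'd]; first by rewrite ltnn.
by case: ltnP => // dd'; rewrite Phat_eq0 ?mulr0 // eq_sym.
Qed.

Lemma hatc_comb (f : par X -> laurent) d :
  hatc (\sum_d' f d' *: Chat P d') d = \sum_d' f d' * P d d'.
Proof.
rewrite /hatc sumE mulr_sumr; apply: eq_bigr => d' _.
by rewrite scaleE Chat_E mulrCA [vpow _ * (P d d' * _)]mulrCA vpowNK mulr1.
Qed.

Lemma coords_comb x : x = \sum_d coords P (hatc x) d *: Chat P d.
Proof.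
apply: hatc_inj => d; rewrite hatc_comb sum_unitriangular.
by rewrite {1}coordsE /coords_step subrK.
Qed.

Lemma coords_comb_unique x f :
  x = \sum_d f d *: Chat P d -> forall d, f d = coords P (hatc x) d.
Proof.
move=> xE d; apply: (@coords_unique _ _ _ _ 0%N) => // d' _.
by rewrite /coords_step {1}xE hatc_comb sum_unitriangular addrK.
Qed.

Lemma Dbar0 : Dbar B 0 = 0.
Proof. by apply: (addIr (Dbar B 0)); rewrite -Dbar_add !add0r. Qed.

(** Applying D to x = sum_d f_d C_d conjugates the f_d, which are unique. *)
Lemma coords_selfdual x d :
  Dbar B x = x -> barL (coords P (hatc x) d) = coords P (hatc x) d.
Proof.
move=> Dx; apply: (@coords_comb_unique x (fun d => barL (coords P (hatc x) d))).
rewrite -{1}Dx {1}[x]coords_comb (big_morph _ (@Dbar_add _ B) Dbar0).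
by apply: eq_bigr => d' _; rewrite Dbar_semilinear Dbar_Chat.
Qed.

Variables (k : Sbar X) (m : par X).
Hypotheses (tm : tau m k) (gm : good_descent (typ m k)).
Let l := below k m.
Let N := That k (Chat P l).

Lemma below_lt : (ell l < ell m)%N.
Proof.
rewrite /l; have [el _ _ _] := below_spec hX tm gm.
by have := lk_defect hX k m; lia.
Qed.

(** The term of lambda in N contributes exactly the subtracted quantity.  A term
    g < lambda of defect 0 contributes a constant multiple of
    P(g, lambda), which has negative degree.  A term of defect 1 does not occur,
    as it would reach length at most l(lambda) + l(k) - 2, which is less
    than l(mu). *)
Lemma hatc_top d : (ell m <= ell d)%N ->
  is_neg (hatc N d - (d == m)%:R * vv ^+ defect m k).
Proof.
move=> md; have lm := below_lt.
have [el dl Tlm abl] := below_spec hX tm gm; rewrite -/l in el dl Tlm abl.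
have Tl : Tmat k l d = (d == m)%:R * vv ^+ defect m k.
  case: eqP => [->|dm]; first by rewrite mul1r.
  by have [->|[_ /abl]] := Tmat_raise hX k (leq_trans lm md); rewrite ?mul0r.
rewrite hatc_That_Chat (bigD1 l) //= Phat_diag mul1r -Tl addrAC subrr add0r.
apply: is_neg_sum => g gl.
have [->|Pgl] := eqVneq (P g l) 0.
  by rewrite mul0r => i _; rewrite coefL0.
have gl' := Phat_lt Pgl gl.
have gd : (ell g < ell d)%N by lia.
have [->|[eg _ [c ->]]] := Tmat_raise hX k gd.
  by rewrite mulr0 => i _; rewrite coefL0.
have -> : defect g k = 0%N.
  case: (defect01 k g) => // dg1.
  by have := lk_defect hX k m; case: (defect01 k m) => dm; lia.
by rewrite expr0 mul1r mulrC; apply/is_neg_intM/Phat_is_neg.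
Qed.

Lemma N_selfdual d : barL (coords P (hatc N) d) = coords P (hatc N) d.
Proof. by apply: coords_selfdual; rewrite Dbar_That Dbar_Chat. Qed.

(** By induction on decreasing length, the correction in the recursion vanishes
    in these lengths, so the coordinate is m_mu or 0 up to an element of
    v^-1 Z[v^-1]; the difference is invariant under v -> v^-1, hence 0. *)
Lemma coords_top d : (ell m <= ell d)%N ->
  coords P (hatc N) d = (d == m)%:R * vv ^+ defect m k.
Proof.
have [n] : exists n, (max_ell X < n + ell d)%N by exists (max_ell X).+1; lia.
elim: n d => [|n IH] d nd md; first by have := ell_max d; lia.
apply/eqP; rewrite -subr_eq0; apply/eqP/selfdual_neg0.
  rewrite barLB N_selfdual; congr (_ - _).
  have bv : barL (vv ^+ defect m k) = vv ^+ defect m k.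
    by apply: bar_vv; case: (defect01 k m) => ->.
  case: eqP => _; rewrite ?mul1r ?mul0r //.
  by apply: coefL_ext => i; rewrite coefL_bar !coefL0.
rewrite coordsE /coords_step big1 ?subr0; first exact: hatc_top.
move=> d' dd'; rewrite IH; [| lia | lia].
case: eqP => [d'm|_]; last by rewrite !mul0r.
by rewrite d'm in dd'; lia.
Qed.

(** The masked entries met by the recursion, other than (g, m) itself, are
    multiplied by coordinates that vanish by [coords_top].  The entry (g, m) is
    read as 0 in place of P(g, m), whence the last summand. *)
Lemma known_coordE g : (ell g < ell m)%N ->
  known_coord k g m (known_part B g m)
  = coords P (hatc N) g + vv ^+ defect m k * P g m.
Proof.
move=> gm'; set Q := known_part B g m.
have QP d d' : (ell d < ell d')%N -> (ell g < ell d)%N ->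
    coords P (hatc N) d' * Q d d' = coords P (hatc N) d' * P d d'.
  move=> dd' gd; rewrite /Q /known_part gd andbT.
  have [//|md'] := ltnP (ell d') (ell m); rewrite coords_top //=.
  by case: eqP => //; rewrite !mul0r.
have QN : Chat Q l = Chat P l.
  by apply: hatc_inj => d; rewrite !hatc_Chat /Q /known_part below_lt.
rewrite /known_coord -/l QN -/N -/Q.
have Qabove d : (ell g < ell d)%N -> coords Q (hatc N) d = coords P (hatc N) d.
  move=> gd; symmetry; apply: (@coords_unique _ _ _ _ (ell g).+1) gd => d' gd'.
  rewrite {1}coordsE /coords_step; congr (_ - _); apply: eq_bigr => d'' dd''.
  by rewrite QP.
rewrite coordsE [coords P _ g]coordsE /coords_step.
have split (f : par X -> laurent) : \sum_(d | (ell g < ell d)%N) f d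
    = f m + \sum_(d | (ell g < ell d)%N && (d != m)) f d by rewrite (bigD1 m).
rewrite !split coords_top // eqxx mul1r [Q g m]/known_part ltnn eqxx ltnn /=.
rewrite mulr0 add0r opprD addrA addrAC addrNK; congr (_ - _).
apply: eq_bigr => d /andP[gd dm]; rewrite Qabove // /Q /known_part (negPf dm).
have [//|md] := ltnP (ell d) (ell m).
by rewrite coords_top // (negPf dm) !mul0r.
Qed.

(** In defect 1 the product of v + v^-1 and P(g, m) has negative degree except
    for a constant term, which is the coefficient of v^-1 in P(g, m). *)
Lemma known_starE g : (ell g < ell m)%N ->
  known_star k g m (known_part B g m) = vv ^+ defect m k * P g m
    - L_of_int (if defect m k == 1%N then mu1 B g m else 0).
Proof.
move=> gm'; rewrite /known_star gm' known_coordE //.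
move: (coords P (hatc N) g) (N_selfdual g) => c cD.
have gm_neq : g != m by apply: contraTneq gm' => ->; rewrite ltnn.
have Pn := Phat_is_neg gm_neq.
apply: coefL_ext => i; rewrite coefL_neg coefLB coefL_bar !coefLB !coefLD.
rewrite -[coefL (- i) c]coefL_bar cD opprD addrACA subrr.
rewrite add0r -[L_of_int _]mulr1 coefL_intM coefL1.
have [dm|dm] := defect01 k m; rewrite dm.
  rewrite expr0 !mul1r mul0r subr0; case: ltP => [i0|/Pn->//].
  by rewrite (Pn (- i)) ?subr0 //; lia.
rewrite expr1 eqxx !coefL_vvM; case: ltP => i0.
  by rewrite (Pn (- i - 1)) ?(Pn (- i + 1)) ?addr0 ?subr0; lia.
rewrite [coefL (i + 1) _]Pn ?addr0; last by lia.
case: eqP => [->|i1]; first by rewrite mulr1 subrr.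
by rewrite Pn ?mulr0 ?subr0 //; lia.
Qed.

Lemma known_PhatE g : known_Phat k g m (known_part B g m) = P g m.
Proof.
rewrite /known_Phat; case: eqVneq => [->|g_m]; first by rewrite Phat_diag.
have [gm'|mg] := ltnP (ell g) (ell m); last first.
  rewrite Phat_eq0 // /known_star ltnNge mg /=; case: ifP => // _.
  by rewrite /solve_vv mul0r negL_id // => i _; rewrite coefL0.
rewrite known_starE //; have [dm|dm] := defect01 k m; rewrite dm /=.
  by rewrite expr0 mul1r subr0.
apply: (@solve_vvP _ _ (mu1 B g m)).
- exact: Phat_is_neg.
- by move=> i; apply: Phat_low.
- by rewrite expr1 addrC subrK.
Qed.

End Canonical.

(** * The theorem *)

Theorem proposition10p3p9 :
  (* (a) *)
  (exists F : known_function laurent,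
     forall (E : lv_setting) (hE : lv_facts E)
            (B : canonical_basis (lvdata_of E))
            (k : Sbar (lvdata_of E)) (g m : par (lvdata_of E)),
       tau g k -> tau m k -> good_descent (typ m k) ->
       ~ (defect m k = 1%N /\
          (ell g < ell m)%N /\ odd `|(ell m)%:Z - (ell g)%:Z|) ->
       Phat B g m = F (lvdata_of E) k g m (known_part B g m))
  /\
  (* (b) *)
  (exists (c : known_function nat) (star F : known_function laurent),
     forall (E : lv_setting) (hE : lv_facts E)
            (B : canonical_basis (lvdata_of E))
            (k : Sbar (lvdata_of E)) (g m : par (lvdata_of E))
            (c0 := c (lvdata_of E) k g m (known_part B g m))
            (star0 := star (lvdata_of E) k g m (known_part B g m)),
       tau g k -> tau m k -> good_descent (typ m k) ->
       defect m k = 1%N ->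
       odd `|(ell m)%:Z - (ell g)%:Z| ->
       [/\ c0 = 1%N \/ c0 = 2%N,
           (v + vpow (- 1)) * Phat B g m = c0%:R * L_of_int (mu1 B g m) + star0,
           forall Q : laurent,
             (v + vpow (- 1)) * Q = c0%:R * L_of_int (coefL (- 1) Q) + star0 ->
             Q = Phat B g m
         & Phat B g m = F (lvdata_of E) k g m (known_part B g m)]).
Proof.
pose solver : known_function laurent :=
  fun X (k : Sbar X) g m P => known_Phat k g m P.
split.
  exists solver => E hE B k g m _ tm gm _.
  by symmetry; apply: (known_PhatE (lv_hecke_rules hE)).
exists (fun _ _ _ _ _ => 1%N).
exists (fun X (k : Sbar X) g m P => known_star k g m P), solver.
move=> E hE B k g m /= _ tm gm dm godd; have hX := lv_hecke_rules hE.
have g_m : g != m by apply: contraTneq godd => ->; rewrite subrr.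
have PE : vv * Phat B g m
    = L_of_int (mu1 B g m) + known_star k g m (known_part B g m).
  have [gm'|mg] := ltnP (ell g) (ell m).
    by rewrite (known_starE hX) // dm expr1 eqxx addrC subrK.
  by rewrite /known_star ltnNge mg /mu1 (Phat_eq0 hX) // mulr0 coefL0 addr0.
split; first by left.
- by rewrite mul1r; exact: PE.
- move=> Q; rewrite mul1r => eqQ; apply/eqP; rewrite -subr_eq0.
  apply/eqP/vv_const0; rewrite mulrBr PE [vv * Q]eqQ coefLB.
  by rewrite /L_of_int mulrzBr opprD addrACA subrr addr0.
- by symmetry; apply: (known_PhatE hX).
Qed.
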